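(* Let $q$ be a prime power and let $a,b\ge0$ be integers. Then each of the following identities holds whenever the exponent on its right-hand side is nonnegative: (1) $g_{(q-2)q^a+(q-1)q^b,\,q}=(S_b-S_a)^{q-2}$; (2) $g_{(q-2)q^a+(q-2)q^b,\,q}=2(S_b-S_a)^{q-3}$; (3) $g_{(q-1)q^a+(q-3)q^b,\,q}=-(S_b-S_a)^{q-3}$; (4) $g_{(q-3)q^a+(q-1)q^b,\,q}=-(S_b-S_a)^{q-3}$; (5) $g_{(q-3)q^a+(q-2)q^b,\,q}=-3(S_b-S_a)^{q-4}$; (6) $g_{(q-2)q^a+(q-3)q^b,\,q}=3(S_b-S_a)^{q-4}$; (7) $g_{(q-3)q^a+(q-3)q^b,\,q}=-6(S_b-S_a)^{q-5}$.
   Context: For a prime power $q$ (a power of the prime $p$) and an integer $n\ge 0$, $g_{n,q}\in\mathbb{F}_p[X]$ denotes the unique polynomial satisfying $\sum_{a\in\mathbb{F}_q}(X+a)^n=g_{n,q}(X^q-X)$. For fixed $q$, $S_0=0$ and $S_k=X+X^q+X^{q^2}+\cdots+X^{q^{k-1}}$ for $k\ge1$. A zeroth power of a polynomial (including the zero polynomial) is $1$. *)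

(* Defs.v *)
From HB Require Import structures.
From mathcomp Require Import all_boot all_order all_algebra all_field.

Set Implicit Arguments.
Unset Strict Implicit.
Unset Printing Implicit Defensive.

Import GRing.Theory.
Local Open Scope ring_scope.

(* The embedding of the prime field: x is read as its representative in
   {0, ..., p-1}. *)
Definition Fp_embed (F : finFieldType) (p : nat) (charFp : p \in [pchar F])
  (x : 'F_p) : F := (x : nat)%:R.

Section FpEmbed.
Variables (F : finFieldType) (p : nat) (charFp : p \in [pchar F]).

Let natrFp n : ((inZp n : 'F_p) : nat)%:R = n%:R :> F.
Proof.
rewrite [in RHS](divn_eq n p) natrD mulrnA (mulrn_pchar charFp) add0r.
by rewrite /= (Fp_cast (pcharf_prime charFp)).
Qed.

Fact Fp_embed_is_zmod_morphism : zmod_morphism (Fp_embed charFp).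
Proof.
suff addE x y : Fp_embed charFp (x + y) = Fp_embed charFp x + Fp_embed charFp y.
  by move=> x y; apply: (addIr (Fp_embed charFp y)); rewrite -addE !subrK.
by rewrite /Fp_embed natrFp natrD.
Qed.

Fact Fp_embed_is_monoid_morphism : monoid_morphism (Fp_embed charFp).
Proof.
split=> [|x y]; first exact: (natrFp 1).
by rewrite /Fp_embed natrFp natrM.
Qed.

HB.instance Definition _ := GRing.isZmodMorphism.Build 'F_p F
  (Fp_embed charFp) Fp_embed_is_zmod_morphism.
HB.instance Definition _ := GRing.isMonoidMorphism.Build 'F_p F
  (Fp_embed charFp) Fp_embed_is_monoid_morphism.

End FpEmbed.

Section Gpoly.
Variables (F : finFieldType) (p : nat) (charFp : p \in [pchar F]).

Local Notation q := #|F|.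
Local Notation toF := (map_poly (Fp_embed charFp)).

Definition gpoly_spec (n : nat) (g : {poly 'F_p}) : bool :=
  \sum_(c : F) ('X + c%:P) ^+ n == toF g \Po ('X^q - 'X).

Lemma size_XqX : size ('X^q - 'X : {poly F}) = q.+1.
Proof.
by rewrite size_polyDl size_polyXn // size_polyN size_polyX ltnS finNzRing_gt1.
Qed.

Lemma XqX_shift (c : F) : ('X^q - 'X) \Po ('X + c%:P) = 'X^q - 'X :> {poly F}.
Proof.
rewrite finField_genPoly rmorph_prod /= (reindex_inj (addIr c)) /=.
apply: eq_bigr => x _.
by rewrite comp_polyB comp_polyX comp_polyC polyCD opprD addrACA subrr addr0.
Qed.

Lemma shift_invariant_descent (h : {poly 'F_p}) :
    (forall c : F, toF h \Po ('X + c%:P) = toF h) ->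
  exists g : {poly 'F_p}, toF h = toF g \Po ('X^q - 'X).
Proof.
have [N] := ubnP (size h); elim: N h => // N IHN h leN hT.
pose Q0 : {poly 'F_p} := 'X^q - 'X.
have toFQ : toF Q0 = 'X^q - 'X by rewrite rmorphB /= map_polyXn map_polyX.
have sQ0 : size Q0 = q.+1 by rewrite -(size_map_poly (Fp_embed charFp)) toFQ size_XqX.
have dvdQ : Q0 %| h - (h`_0)%:P.
  rewrite -(dvdp_map (Fp_embed charFp)) toFQ finField_genPoly -big_enum.
  apply: uniq_roots_dvdp; last by rewrite uniq_rootsE enum_uniq.
  apply/allP=> c _; rewrite rootE rmorphB /= map_polyC /= hornerD hornerN hornerC.
  rewrite -{1}(hT (- c)) horner_comp !hornerE subrr -[X in X.[0]]/(toF h).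
  by rewrite horner_coef0 coef_map subrr.
have [k hE] : exists k, h = k * Q0 + (h`_0)%:P.
  by have /dvdpP[k kE] := dvdQ; exists k; rewrite -kE subrK.
have [k0|nzk] := eqVneq k 0.
  exists (h`_0)%:P; rewrite {1}hE k0 mul0r add0r.
  by rewrite map_polyC /= comp_polyC.
have nzQ : Q0 != 0 by rewrite -size_poly_eq0 sQ0.
have szk : (size k < N)%N.
  have q_gt1 : (1 < q)%N := finNzRing_gt1 F.
  have szkQ : size (k * Q0) = (size k + q)%N by rewrite size_mul // sQ0 addnS.
  have k_gt0 : (0 < size k)%N by rewrite size_poly_gt0.
  apply: leq_trans (_ : size h <= N)%N => //.
  rewrite hE size_polyDl szkQ; first by rewrite -addn1 leq_add2l ltnW.
  by apply: leq_ltn_trans (size_polyC_leq1 _) _; rewrite -addn1 leq_add // ltnW.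
have [c|g gE] := IHN k szk.
  have := hT c; rewrite hE rmorphD rmorphM /= toFQ map_polyC /=.
  rewrite comp_polyD comp_polyM comp_polyC XqX_shift => /addIr/mulIf-> //.
  by rewrite -size_poly_eq0 size_XqX.
exists (g * 'X + (h`_0)%:P).
rewrite {1}hE !rmorphD !rmorphM /= toFQ gE map_polyX map_polyC /=.
by rewrite comp_polyX comp_polyC.
Qed.

Lemma sum_expF_nat (j : nat) : exists m : nat, \sum_(c : F) c ^+ j = m%:R.
Proof.
have [/existsP[u /andP[nzu nu1]]|/existsPn eq1] :=
  boolP [exists u : F, (u != 0) && (u ^+ j != 1)].
  exists 0; apply/eqP; rewrite -[_ == _]orFb.
  have := erefl (\sum_(c : F) c ^+ j); rewrite [in LHS](reindex_inj (mulfI nzu)).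
  under eq_bigr do rewrite exprMn.
  rewrite -mulr_sumr => /eqP; rewrite -subr_eq0 -[X in _ - X]mul1r -mulrBl mulf_eq0.
  by rewrite subr_eq0 (negPf nu1).
exists ((j == 0%N) + #|[pred c : F | c != 0%R]|)%N.
rewrite (bigD1 (0 : F)) //= expr0n natrD -sum1_card natr_sum; congr (_ + _).
apply: eq_bigr => c nzc; apply/eqP.
by have := eq1 c; rewrite nzc /= negbK.
Qed.

Lemma gpoly_exists (n : nat) : exists g, gpoly_spec n g.
Proof.
have [h hE] : exists h, toF h = \sum_(c : F) ('X + c%:P) ^+ n.
  under eq_bigr do rewrite exprDn.
  rewrite exchange_big /=.
  elim/big_ind: _ => [|_ _ [h1 <-] [h2 <-]|j _]; first by exists 0; rewrite rmorph0.
    by exists (h1 + h2); rewrite rmorphD.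
  have [m mE] := sum_expF_nat j.
  exists (('X^(n - j) * m%:R) *+ 'C(n, j)).
  rewrite rmorphMn rmorphM rmorph_nat /= map_polyXn sumrMnl -mulr_sumr.
  congr ((_ * _) *+ _); rewrite -(rmorph_nat polyC) -mE rmorph_sum.
  by apply: eq_bigr => c _; rewrite rmorphXn.
have [c|g gE] := @shift_invariant_descent h; last by exists g; rewrite /gpoly_spec -hE gE.
rewrite hE rmorph_sum /= [RHS](reindex_inj (addIr c)) /=.
apply: eq_bigr => x _; rewrite rmorphXn /= comp_polyD comp_polyX comp_polyC.
by rewrite polyCD addrAC addrA.
Qed.

Lemma gpoly_unique (n : nat) (g1 g2 : {poly 'F_p}) :
  gpoly_spec n g1 -> gpoly_spec n g2 -> g1 = g2.
Proof.
rewrite /gpoly_spec => /eqP-> /eqP g12; apply: (map_poly_inj (Fp_embed charFp)).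
apply/eqP; rewrite -subr_eq0; move/eqP: g12; rewrite -subr_eq0 -comp_polyB.
by rewrite comp_poly_eq0 // size_XqX ltnS ltnW ?finNzRing_gt1.
Qed.

(* g_{n,q} for q = #|F|. *)
Definition gpoly (n : nat) : {poly 'F_p} := xchoose (gpoly_exists n).

Lemma gpolyP (n : nat) :
  \sum_(c : F) ('X + c%:P) ^+ n = toF (gpoly n) \Po ('X^q - 'X).
Proof. exact/eqP/(xchooseP (gpoly_exists n)). Qed.

End Gpoly.

Definition Spoly (R : nzRingType) (q k : nat) : {poly R} :=
  \sum_(i < k) 'X^(q ^ i).

(* Main.v *)
(** Write [A = X^(q^a)], [B = X^(q^b)] and [D = B - A], which is
    [S_b - S_a] evaluated at [X^q - X]. The sum defining [g] is
    [\sum_c (A + c)^m ((A + c) + D)^n]; expanding the second factor in powers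
    of [D] leaves the power sums [\sum_c (A + c)^k] with [k < 2q - 2], all of
    which vanish except the one for [k = q - 1], equal to [-1]. Hence only one
    term survives, and its coefficient is a binomial coefficient
    ['C(q - i, j)] that reduces modulo [p]. *)
Require Import Defs.
From mathcomp Require Import all_boot all_order all_algebra all_field.
From mathcomp Require Import ring zify.

Import GRing.Theory.
Local Open Scope ring_scope.

(* The elaborator produces several convertible but syntactically distinct forms
   of [#|F|], which [lia] would treat as unrelated atoms. *)
Ltac card_lia F :=
  let N := fresh "N" in
  pose N := #|F|;
  repeat match goal with
  | |- context [@card.body ?T ?A] => change (@card.body T A) with N
  | H : context [@card.body ?T ?A] |- _ => lazymatch H with
      | N => fail | _ => change (@card.body T A) with N in H end
  end;
  clearbody N; lia.

Section PowerSums.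
Variable F : finFieldType.
Local Notation q := #|F|.

Lemma card_pnat (p : nat) : p \in [pchar F] -> p.-nat q.
Proof.
move=> charFp; rewrite (card_pprimeChar charFp) pnatX.
by rewrite pnat_id // (pcharf_prime charFp).
Qed.

(** The characteristic divides [q]. The ring [R] is kept separate from [F] because the fact serves
    both in [F] and in [{poly 'F_p}]. *)
Lemma natr_card_eq0 (R : nzRingType) (p : nat) :
  p \in [pchar F] -> p \in [pchar R] -> q%:R = 0 :> R.
Proof.
move=> charFp charRp; apply/eqP; rewrite -(dvdn_pcharf charRp).
have := card_pnat _ charFp; rewrite (card_pprimeChar charFp).
case: (logn _ _) (card_pprimeChar charFp) => [|k] qE _; last by rewrite expnS dvdn_mulr.
by have := finNzRing_gt1 F; rewrite qE.
Qed.

(** For [k = q - 1] the nonzero [c] contribute 1 each, giving [q - 1 = -1]; for [k = 0] every term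
    is 1, including that of [c = 0]. Otherwise some nonzero [u] has [u ^+ k != 1], and substituting
    [u * c] for [c] multiplies the sum by [u ^+ k], so it vanishes. *)
Lemma sum_expF (k : nat) :
  (k < q)%N -> \sum_(c : F) c ^+ k = - (k == q.-1)%:R.
Proof.
have q_gt1 := finNzRing_gt1 F; have [p _ charFp] := finPcharP F.
have q0 : q%:R = 0 :> F by exact: (natr_card_eq0 _ _ charFp).
move=> ltkq; have [->|nekq] := eqVneq k q.-1.
  rewrite (bigD1 (0 : F)) //= expr0n -subn1 subn_eq0 leqNgt q_gt1 add0r.
  rewrite (eq_bigr (fun=> 1)) => [|c nzc].
    rewrite sumr_const (cardC1 (0 : F)) -subn1 mulrnBr ?(ltnW q_gt1) //.
    by rewrite q0 sub0r.
  by apply: (mulfI nzc); rewrite -exprS subn1 prednK 1?ltnW // expf_card mulr1.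
rewrite oppr0; case: k => [|k] in ltkq nekq *.
  by rewrite sumr_const.
have [/existsP[u /andP[nzu nu1]]|/existsPn eq1] :=
    boolP [exists u : F, (u != 0) && (u ^+ k.+1 != 1)].
  apply/eqP; have /eqP := erefl (\sum_(c : F) c ^+ k.+1).
  rewrite [in X in X == _](reindex_inj (mulfI nzu)).
  under eq_bigr do rewrite exprMn.
  rewrite -mulr_sumr -subr_eq0 -[X in _ - X]mul1r -mulrBl mulf_eq0.
  by rewrite subr_eq0 (negPf nu1).
(* If there were no such [u], all [q] elements of [F] would be roots of this polynomial, whose
   degree is too small. *)
have sP : size ('X^(k.+2) - 'X : {poly F}) = k.+3.
  by rewrite size_polyDl size_polyXn // size_polyN size_polyX.
have nzP : 'X^(k.+2) - 'X != 0 :> {poly F} by rewrite -size_poly_eq0 sP.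
have rootP : all (root ('X^(k.+2) - 'X)) (enum F).
  apply/allP => c _; rewrite rootE !hornerE.
  have [->|nzc] := eqVneq c 0; first by rewrite exprS mul0r subrr.
  have := eq1 c; rewrite nzc /= negbK => /eqP ck.
  by rewrite exprS ck mulr1 subrr.
have := max_poly_roots nzP rootP (enum_uniq F).
rewrite -cardE sP ltnS => leqk; have qE : q = k.+2 by apply/eqP; rewrite eqn_leq leqk.
by rewrite qE eqxx in nekq.
Qed.

(** Below [q], only the top power of [c] in the binomial expansion can have exponent [q - 1]. From
    [q] on, [(A + c)^q = (A^q - A) + (A + c)] lowers the exponent to [k - q] and [k - q + 1]; the
    bound on [k] keeps both below [q - 1]. *)
Lemma sum_exp_shift (A : {poly F}) (k : nat) :
  (k < 2 * q - 2)%N -> \sum_(c : F) (A + c%:P) ^+ k = - (k == q.-1)%:R.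
Proof.
have q_gt1 := finNzRing_gt1 F; have [p _ charFp] := finPcharP F.
have smallP j : (j < q)%N ->
    \sum_(c : F) (A + c%:P) ^+ j = - (j == q.-1)%:R.
  move=> ltjq; under eq_bigr do rewrite exprDn.
  rewrite exchange_big /= big_ord_recr /= subnn expr0 binn.
  rewrite big1 ?add0r => [|i _].
    under eq_bigr do rewrite mul1r mulr1n -rmorphXn.
    by rewrite -rmorph_sum sum_expF //= rmorphN rmorph_nat.
  rewrite sumrMnl -mulr_sumr; under eq_bigr do rewrite -rmorphXn.
  have ltij := ltn_ord i.
  rewrite -rmorph_sum sum_expF /=; last by card_lia F.
  have -> : (i == q.-1 :> nat) = false by apply/eqP; card_lia F.
  by rewrite oppr0 rmorph0 mulr0 mul0rn.
move=> ltk; have [/smallP//|leqk] := ltnP k q.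
have expq c : (A + c%:P) ^+ q = A ^+ q + c%:P.
  rewrite exprDn_pchar; first by rewrite -rmorphXn /= expf_card.
  rewrite (eq_pnat _ (pchar_poly F)) (eq_pnat _ (pcharf_eq charFp)).
  exact: card_pnat.
pose r := (k - q)%N; have kE : k = (q + r)%N by rewrite subnKC.
have -> : \sum_(c : F) (A + c%:P) ^+ k =
    (A ^+ q - A) * (\sum_(c : F) (A + c%:P) ^+ r)
      + \sum_(c : F) (A + c%:P) ^+ r.+1.
  rewrite mulr_sumr -big_split; apply: eq_bigr => c _ /=.
  by rewrite kE exprD expq exprS; ring.
rewrite !smallP; [|card_lia F|card_lia F].
have -> : (r == q.-1) = false by apply/eqP; card_lia F.
have -> : (r.+1 == q.-1) = false by apply/eqP; card_lia F.
have -> : (k == q.-1) = false by apply/eqP; card_lia F.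
by rewrite oppr0 mulr0 addr0.
Qed.

Lemma sum_exp_shift2 (A D : {poly F}) (m n j : nat) :
    (m + j = q.-1)%N -> (m + n < 2 * q - 2)%N ->
  \sum_(c : F) (A + c%:P) ^+ m * (A + D + c%:P) ^+ n
    = - ('C(n, j)%:R * D ^+ (n - j)).
Proof.
move=> mj mn.
have -> : \sum_(c : F) (A + c%:P) ^+ m * (A + D + c%:P) ^+ n =
    \sum_(i < n.+1)
      'C(n, i)%:R * D ^+ (n - i) * \sum_(c : F) (A + c%:P) ^+ (m + i).
  under [RHS]eq_bigr do rewrite mulr_sumr.
  rewrite exchange_big; apply: eq_bigr => c _ /=.
  rewrite (_ : A + D + _ = D + (A + c%:P)); last by ring.
  rewrite (exprDn D) mulr_sumr; apply: eq_bigr => i _.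
  by rewrite exprD -mulr_natl; ring.
have sumE (i : 'I_n.+1) :
    \sum_(c : F) (A + c%:P) ^+ (m + i) = - (i == j :> nat)%:R.
  by rewrite sum_exp_shift -?mj ?eqn_add2l //; have := ltn_ord i; card_lia F.
under eq_bigr do rewrite sumE.
have [lejn|ltnj] := leqP j n.
  rewrite (bigD1 (inord j)) //= inordK // eqxx mulrN1 big1 ?addr0 // => i.
  by rewrite -val_eqE /= inordK // => /negPf->; rewrite oppr0 mulr0.
(* For [j > n] no index equals [j], and the binomial coefficient is 0, so the truncated [n - j] is
   harmless. *)
rewrite bin_small // mul0r oppr0 big1 // => i _.
have := ltn_ord i; have [->|_ _] := eqVneq (i : nat) j; first by rewrite ltnS leqNgt ltnj.
by rewrite oppr0 mulr0.
Qed.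

End PowerSums.

Section Binomials.
Variables (F : finFieldType) (p : nat) (charFp : p \in [pchar F]).
Variables (R : nzRingType) (charRp : p \in [pchar R]).
Local Notation q := #|F|.

Lemma natr_cardB (i : nat) : (i <= q)%N -> (q - i)%:R = - i%:R :> R.
Proof. by move=> leiq; rewrite natrB // (natr_card_eq0 _ _ _ charFp) // sub0r. Qed.

(** Since [j 'C(q, j) = q 'C(q - 1, j - 1)], a coefficient prime to [p] would force [q] to divide
    [j]. *)
Lemma natr_bin_card (j : nat) : (0 < j < q)%N -> 'C(q, j)%:R = 0 :> R.
Proof.
case/andP; case: j => // j _ ltjq; apply/eqP; rewrite -(dvdn_pcharf charRp).
apply: contraLR ltjq => ndvd; rewrite -leqNgt dvdn_leq //.
have coqC : coprime q 'C(q, j.+1).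
  by rewrite {1}(card_pprimeChar charFp) coprimeXl ?prime_coprime ?(pcharf_prime charFp).
by rewrite -(Gauss_dvdl _ coqC) -mul_bin_diag dvdn_mulr.
Qed.

(** By Pascal's rule, passing from ['C(q - i, 2)] to ['C(q - i.+1, 2)] subtracts [q - i.+1], that
    is, adds [i.+1] in [R]. Starting from ['C(q, 2) = 0], this gives 1, 3, 6. *)
Lemma natr_bin_cardB2 :
  [/\ ((3 <= q)%N -> 'C(q - 1, 2)%:R = 1 :> R),
      ((3 <= q)%N -> 'C(q - 2, 2)%:R = 3%:R :> R) &
      ((4 <= q)%N -> 'C(q - 3, 2)%:R = 6%:R :> R)].
Proof.
have pascal i : (i < q)%N ->
    'C(q - i.+1, 2)%:R = 'C(q - i, 2)%:R + i.+1%:R :> R.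
  move=> ltiq; have -> : (q - i = (q - i.+1).+1)%N by card_lia F.
  by rewrite binS bin1 natrD (natr_cardB i.+1 ltiq) subrK.
have C1 : (3 <= q)%N -> 'C(q - 1, 2)%:R = 1 :> R.
  by move=> q3; rewrite pascal ?subn0 ?natr_bin_card ?add0r //; card_lia F.
have C2 : (3 <= q)%N -> 'C(q - 2, 2)%:R = 3%:R :> R.
  by move=> q3; rewrite pascal ?C1 -?natrD //; card_lia F.
by split=> // q4; rewrite pascal ?C2 -?natrD //; card_lia F.
Qed.

End Binomials.

Section GpolyMonomialPair.
Variables (F : finFieldType) (p : nat) (charFp : p \in [pchar F]).
Local Notation q := #|F|.
Local Notation toF := (map_poly (Fp_embed charFp)).

Lemma exprD_card (A B : {poly F}) (i : nat) :
  (A + B) ^+ (q ^ i) = A ^+ (q ^ i) + B ^+ (q ^ i).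
Proof.
apply: exprDn_pchar; rewrite (eq_pnat _ (pchar_poly F)).
by rewrite (eq_pnat _ (pcharf_eq charFp)) pnatX card_pnat.
Qed.

Lemma expf_card_exp (c : F) (i : nat) : c ^+ (q ^ i) = c.
Proof. by elim: i => [|i IHi]; rewrite ?expr1 // expnS exprM expf_card. Qed.

(** The Frobenius map turns the sum into a telescoping one. *)
Lemma Spoly_comp (k : nat) :
  toF (Spoly 'F_p q k) \Po ('X^q - 'X) = 'X^(q ^ k) - 'X.
Proof.
rewrite /Spoly rmorph_sum raddf_sum /=.
transitivity (\sum_(0 <= i < k) ('X^(q ^ i.+1) - 'X^(q ^ i) : {poly F})).
  rewrite big_mkord; apply: eq_bigr => i _.
  rewrite map_polyXn rmorphXn /= comp_polyX exprD_card -exprM -expnS.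
  (* The sign comes out of the power by additivity applied to ['X + (- 'X) = 0], which avoids a case
     split on the parity of [q]. *)
  congr (_ + _); apply: (addrI ('X ^+ (q ^ i))).
  by rewrite -exprD_card !subrr expr0n expn_eq0 -leqn0 leqNgt ltnW ?finNzRing_gt1.
by rewrite telescope_sumr // expr1.
Qed.

(** By uniqueness, it suffices that the right-hand side satisfies the defining identity. As [c] is
    fixed by Frobenius, [('X + c)^(q^a)] is ['X^(q^a) + c], so [sum_exp_shift2] applies. *)
Lemma gpoly_two_powers (a b m n j : nat) :
    (m + j = q.-1)%N -> (m + n < 2 * q - 2)%N ->
  gpoly charFp (m * q ^ a + n * q ^ b)%N
    = - ('C(n, j)%:R * (Spoly 'F_p q b - Spoly 'F_p q a) ^+ (n - j)).
Proof.
move=> mj mn; apply: (@gpoly_unique _ _ charFp (m * q ^ a + n * q ^ b)).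
  by apply/eqP; exact: gpolyP.
pose A : {poly F} := 'X^(q ^ a); pose D : {poly F} := 'X^(q ^ b) - A.
apply/eqP; transitivity (\sum_(c : F) (A + c%:P) ^+ m * (A + D + c%:P) ^+ n).
  apply: eq_bigr => c _; rewrite exprD mulnC exprM exprD_card -rmorphXn /=.
  rewrite expf_card_exp (mulnC n) exprM exprD_card -rmorphXn /= expf_card_exp.
  by rewrite [A + D]addrC subrK.
rewrite (sum_exp_shift2 _ _ _ _ _ _ mj mn).
rewrite !(rmorphN, rmorphM, rmorphXn, rmorphB, rmorph_nat) /= !Spoly_comp.
by rewrite opprB addrA subrK.
Qed.

End GpolyMonomialPair.

Theorem lemma2p6 (p : nat) (F : finFieldType) (charFp : p \in [pchar F])
    (a b : nat) :
  let q := #|F| in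
  let g := gpoly charFp in
  let S := Spoly 'F_p q in
  [/\ ((2 <= q)%N ->
        g ((q - 2) * q ^ a + (q - 1) * q ^ b)%N = (S b - S a) ^+ (q - 2)),
      ((3 <= q)%N ->
        g ((q - 2) * q ^ a + (q - 2) * q ^ b)%N
          = 2%:R * (S b - S a) ^+ (q - 3)),
      ((3 <= q)%N ->
        g ((q - 1) * q ^ a + (q - 3) * q ^ b)%N = - ((S b - S a) ^+ (q - 3))) &
      ((3 <= q)%N ->
        g ((q - 3) * q ^ a + (q - 1) * q ^ b)%N = - ((S b - S a) ^+ (q - 3)))] /\
  [/\ ((4 <= q)%N ->
        g ((q - 3) * q ^ a + (q - 2) * q ^ b)%N
          = - 3%:R * (S b - S a) ^+ (q - 4)),
      ((4 <= q)%N ->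
        g ((q - 2) * q ^ a + (q - 3) * q ^ b)%N
          = 3%:R * (S b - S a) ^+ (q - 4)) &
      ((5 <= q)%N ->
        g ((q - 3) * q ^ a + (q - 3) * q ^ b)%N
          = - 6%:R * (S b - S a) ^+ (q - 5))].
Proof.
move=> q g S; have q_gt1 : (2 <= q)%N := finNzRing_gt1 F.
have charPp : p \in [pchar {poly 'F_p}].
  by rewrite pchar_poly; apply: pchar_Fp; exact: pcharf_prime charFp.
have natrB i : (i <= q)%N -> (q - i)%:R = - i%:R :> {poly 'F_p}.
  exact: (natr_cardB _ _ charFp _ charPp).
have := natr_bin_cardB2 _ _ charFp _ charPp; rewrite -/q => -[C1 C2 C3].
have gE m n j : (m + j = q.-1)%N -> (m + n < 2 * q - 2)%N ->
    g (m * q ^ a + n * q ^ b)%N = - ('C(n, j)%:R * (S b - S a) ^+ (n - j)).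
  exact: gpoly_two_powers.
(* The values [q - 1], [q - 2], [q - 3] of [m] force [j] to be 0, 1, 2. It remains to reduce
   ['C(n, j)] modulo [p]. *)
split; split=> leq.
- rewrite (gE _ _ 1%N) ?bin1 ?natrB ?mulN1r ?opprK; [|lia..].
  by rewrite -subnDA.
- rewrite (gE _ _ 1%N) ?bin1 ?natrB ?mulNr ?opprK; [|lia..].
  by rewrite -subnDA.
- by rewrite (gE _ _ 0%N) ?bin0 ?mul1r ?subn0; [|lia..].
- rewrite (gE _ _ 2%N) ?C1 ?mul1r; [|lia..].
  by rewrite -subnDA.
- rewrite (gE _ _ 2%N) ?C2 ?mulNr; [|lia..].
  by rewrite -subnDA.
- rewrite (gE _ _ 1%N) ?bin1 ?natrB ?mulNr ?opprK; [|lia..].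
  by rewrite -subnDA.
- rewrite (gE _ _ 2%N) ?C3 ?mulNr; [|lia..].
  by rewrite -subnDA.
Qed.
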